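(* Let $X$ be an irreducible continuum. If $NC_1(X)\cap F_1(X)=NWC_1(X)\cap F_1(X)$, then $X$ is an arc.
   Context: All spaces are metric; a continuum is a compact connected space with more than one point. For a non-empty space $Y$: $2^Y$ is the set of non-empty compact subsets of $Y$; $F_1(Y)$ is the set of one-point subsets of $Y$; the subcontinua of $Y$ are the non-empty compact connected subsets of $Y$. An arc is a space homeomorphic to $[0,1]$. A continuum $X$ is irreducible if there exist $p,q\in X$ such that no proper subcontinuum of $X$ contains $\{p,q\}$. A non-empty space $Y$ is $1$-$Q2$ if there exists a one-point set $B\subset Y$ such that for each $x\in Y$ there exists a continuum $D\subset Y$ with $x\in D$ and $B\cap D\neq\emptyset$. For a continuum $X$: $NWC_1(X)=\{A\in 2^X: A=X$ or $X-A$ is $1$-$Q2\}$; $NC_1(X)=\{A\in 2^X: X-A$ has at most one component$\}$. *)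

(* Defs.v *)
From HB Require Import structures.
From mathcomp Require Import all_boot all_order all_algebra.
From mathcomp Require Import all_classical all_reals all_analysis.

Set Implicit Arguments.
Unset Strict Implicit.
Unset Printing Implicit Defensive.

Import Order.TTheory GRing.Theory Num.Theory.
Import numFieldNormedType.Exports.

Local Open Scope classical_set_scope.
Local Open Scope ring_scope.

(* A subset of a space is identified with the subspace it carries, so the
   notions below are predicates on sets and [set: X] stands for X itself. *)

Section Continua.
Context {T : topologicalType}.
Implicit Types A C D Y : set T.

(* Continua are nondegenerate, whereas subcontinua may be singletons. *)
Definition continuum A : Prop :=
  [/\ compact A, connected A & exists x y, [/\ A x, A y & x <> y]].

Definition subcontinuum Y C : Prop :=
  [/\ C `<=` Y, C !=set0, compact C & connected C].

Definition irreducible Y : Prop :=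
  exists p q, [/\ Y p, Y q &
    forall C, subcontinuum Y C -> [set p; q] `<=` C -> C = Y].

Definition hyperspace Y : set (set T) :=
  [set A | [/\ A `<=` Y, A !=set0 & compact A]].

Definition F_1 Y : set (set T) := [set [set x] | x in Y].

Definition oneQ2 Y : Prop :=
  Y !=set0 /\
  exists2 B, F_1 Y B &
    forall x, Y x ->
      exists D, [/\ continuum D, D `<=` Y, D x & B `&` D !=set0].

Definition components Y : set (set T) :=
  [set connected_component Y x | x in Y].

End Continua.

Definition NWC_1 (X : topologicalType) : set (set X) :=
  [set A | hyperspace [set: X] A /\ (A = [set: X] \/ oneQ2 ([set: X] `\` A))].

Definition NC_1 (X : topologicalType) : set (set X) :=
  [set A | hyperspace [set: X] A /\ is_subset1 (components ([set: X] `\` A))].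

Arguments NWC_1 X : clear implicits.
Arguments NC_1 X : clear implicits.

Definition homeomorphic (T U : topologicalType) : Prop :=
  exists (f : T -> U) (g : U -> T),
    [/\ cancel f g, cancel g f, continuous f & continuous g].

(* The interval is a type here, with the subspace topology of R. *)
Definition is_arc (R : realType) (X : topologicalType) : Prop :=
  homeomorphic X (set_type (`[0, 1] : set R)).

(* Main.v *)
Require Import Defs.
From HB Require Import structures.
From mathcomp Require Import all_boot all_order all_algebra.
From mathcomp Require Import all_classical all_reals all_analysis.
From mathcomp Require Import ring lra.
Import Order.TTheory GRing.Theory Num.Theory.
Import numFieldNormedType.Exports.
Set Implicit Arguments.
Unset Strict Implicit.
Unset Printing Implicit Defensive.
Local Open Scope classical_set_scope.
Local Open Scope ring_scope.

(** Let [X] be irreducible between [p] and [q], and let [x] be another point.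
    A complement of [x] that is 1-Q2 would contain a continuum joining [p] to
    [q], against irreducibility; so the complement of [x] is not 1-Q2, and the
    hypothesis turns this into the statement that [x] cuts [X]. Irreducibility
    also forces [p] and [q] to be on different sides of [x]
    ([irreducible_cut_pair]).

    A continuum cut in this way by all points other than [p] and [q] is an
    arc. Saying that [y] precedes [x] when [y] is on the [p]-side of [x] defines
    a strict total order with open rays ([order_of_cut_pairs]), and
    connectedness makes it dense ([ray_dense]). Let [d] be a dense sequence. The
    distance from [d n] to the set of points up to [x] is a nonincreasing
    function of [x], continuous by compactness and density of the order
    ([running_min]). A convergent weighted sum of these functions
    ([separating_sum]) is continuous and strictly decreasing, hence injective
    ([ordered_continuum_embedding]). A compact connected space with two points
    and a continuous injection into the line is homeomorphic to the unit
    interval ([injection_arc]). *)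

(** * Separating a connected space at a point *)

Lemma clopen_setT (X : topologicalType) (A : set X) :
  connected [set: X] -> A !=set0 -> open A -> closed A -> A = [set: X].
Proof. by move=> cX A0 oA cA; apply: cX => //; exists A; rewrite ?setTI. Qed.

Lemma union_side (T : Type) (x y : T) (U V : set T) :
  U `|` V = ~` [set x] -> y <> x -> U y \/ V y.
Proof. by move=> UVx yx; have : (~` [set x]) y by []; rewrite -UVx. Qed.

Lemma side_neq (T : Type) (x y : T) (U V : set T) :
  U `|` V = ~` [set x] -> U y \/ V y -> y <> x.
Proof. by move=> UVx Hy; have : (~` [set x]) y by rewrite -UVx. Qed.

Lemma disjoint_sides (T : Type) (x : T) (U V : set T) :
  U `&` V = set0 -> U x -> V x -> False.
Proof. by move=> UV0 Ux Vx; have : (U `&` V) x by []; rewrite UV0. Qed.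

Lemma side_with_point (X : topologicalType) (x : X) (U V : set X) :
  U `&` V = set0 -> U `|` V = ~` [set x] -> U `|` [set x] = ~` V.
Proof.
move=> UV0 UVx; apply/seteqP; split => z.
- case=> [Uz Vz|-> Vx].
  + exact: (disjoint_sides UV0 Uz Vz).
  + exact: (side_neq UVx (or_intror Vx)).
- move=> nVz; have [->|/eqP zx] := eqVneq z x; first by right.
  by have [|//] := union_side UVx zx; left.
Qed.

(** A relatively clopen part of [U `|` [set x]] that misses [x] lies in [U], so
    it is open in the whole space; being also closed in the closed set
    [~` V], it is clopen in a connected space, hence empty. *)
Lemma connected_side (X : topologicalType) (x : X) (U V : set X) :
  connected [set: X] -> open U -> open V -> U `&` V = set0 ->
  U `|` V = ~` [set x] -> connected (U `|` [set x]).
Proof.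
move=> cX oU oV UV0 UVx.
have UE := side_with_point UV0 UVx.
have cU : closed (U `|` [set x]) by rewrite UE; exact: open_closedC.
have Ux : (U `|` [set x]) x by right.
(* A relatively clopen trace missing [x] is empty; used for the given clopen set
   and, when that set contains [x], for its complement. *)
have key (O C : set X) : open O -> closed C ->
    (U `|` [set x]) `&` O = (U `|` [set x]) `&` C -> ~ O x ->
    (U `|` [set x]) `&` O = set0.
  move=> oO cC OC nOx; apply: contrapT => /eqP/set0P ne.
  have E : (U `|` [set x]) `&` O = U `&` O.
    apply/seteqP; split=> z [Hz Oz]; split=> //; last by left.
    by case: Hz => // zx; case: nOx; rewrite -zx.
  have : (U `|` [set x]) `&` O = [set: X].
    apply: clopen_setT => //; first by rewrite E; exact: openI.
    by rewrite OC; exact: closedI.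
  by move=> /seteqP[_ /(_ x I)[_ /nOx]].
move=> B B0 [ O oO BO] [C cC BC].
have OC : (U `|` [set x]) `&` O = (U `|` [set x]) `&` C by rewrite -BO.
have [Ox|nOx] := pselect (O x); last first.
  by move: B0; rewrite BO (key O C)// => /set0P/eqP.
have CE : (U `|` [set x]) `&` ~` C = (U `|` [set x]) `&` ~` O.
  apply/seteqP; split => z [Uz nz]; split => // ?; apply: nz.
    by have [] : ((U `|` [set x]) `&` C) z by rewrite -OC.
  by have [] : ((U `|` [set x]) `&` O) z by rewrite OC.
have C0 : (U `|` [set x]) `&` ~` C = set0.
  apply: (key _ (~` O) _ _ CE); [exact: closed_openC|exact: open_closedC|].
  by apply; have [] : ((U `|` [set x]) `&` C) x by rewrite -OC.
rewrite BC; apply/seteqP; split => [z []//|z Uz]; split => //.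
apply: contrapT => nCz.
by have : ((U `|` [set x]) `&` ~` C) z by []; rewrite C0.
Qed.

Lemma connected_in_side (X : topologicalType) (x : X) (U V C : set X) :
  open U -> open V -> U `&` V = set0 ->
  U `|` V = ~` [set x] -> connected C -> ~ C x -> C `&` U !=set0 -> C `<=` U.
Proof.
move=> oU oV UV0 UVx cC nCx CU.
(* [C `&` U] is the trace of [U] and of the closed set [~` V]. *)
suff <- : C `&` U = C by move=> z [].
apply: cC => //; first by exists U.
exists (~` V); first exact: open_closedC.
rewrite -(side_with_point UV0 UVx).
apply/seteqP; split => z [Cz]; first by split => //; left.
by case=> // zx; case: nCx; rewrite -zx.
Qed.

(** * The order of an irreducible continuum *)

(** The two sides of a cut point [x], [U] the side of [p] and [V] the side of
    [q]. The clauses on [p] and [q] are guarded so that the end points also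
    have cut pairs, with one side empty; this spares every later argument a
    case distinction. *)
Definition cut_pair (X : topologicalType) (p q x : X) (U V : set X) :=
  [/\ open U, open V, U `&` V = set0, U `|` V = ~` [set x] &
      (p <> x -> U p) /\ (q <> x -> V q)].

Lemma cut_pair_sym (X : topologicalType) (p q x : X) (U V : set X) :
  cut_pair p q x U V -> cut_pair q p x V U.
Proof. by case=> oU oV UV0 UVx [Up Vq]; split; rewrite 1?setIC 1?setUC. Qed.

(** If [x] were also on the [p]-side of [y], the connected set formed by [y] and
    its [q]-side would avoid [x], so it would stay on the [p]-side of [x]
    together with [q]. *)
Lemma cut_pair_swap (X : topologicalType) (p q x y : X) (U V U' V' : set X) :
  connected [set: X] -> cut_pair p q x U V -> cut_pair p q y U' V' ->
  U y -> V' x.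
Proof.
move=> cX [oU oV UV0 UVx [Up Vq]] [oU' oV' UV0' UVy [Up' Vq']] Uy.
have yx : y <> x by apply: (side_neq UVx); left.
have [U'x|//] := union_side UVy (nesym yx).
have cR : connected (V' `|` [set y]).
  by apply: (connected_side cX oV' oU'); rewrite 1?setIC 1?setUC.
have nV'x : ~ V' x by exact: disjoint_sides UV0' U'x.
have RU : V' `|` [set y] `<=` U.
  apply: (connected_in_side oU oV UV0 UVx cR).
    by case=> // /esym.
  by exists y; split=> //; right.
have Uq : U q.
  by apply: RU; have [->|/eqP] := eqVneq q y; [right|move/Vq'; left].
have qx : q <> x by apply: (side_neq UVx); left.
by case: (disjoint_sides UV0 Uq); exact: Vq.
Qed.

(** The connected set formed by [y] and its [p]-side avoids [x], by
    [cut_pair_swap], and meets [U] at [y]. *)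
Lemma cut_pair_trans (X : topologicalType) (p q x y : X) (U V U' V' : set X) :
  connected [set: X] -> cut_pair p q x U V -> cut_pair p q y U' V' ->
  U y -> U' `<=` U.
Proof.
move=> cX cx cy Uy; have V'x := cut_pair_swap cX cx cy Uy.
case: cx => oU oV UV0 UVx _; case: cy => oU' oV' UV0' UVy _.
have yx : y <> x by apply: (side_neq UVx); left.
apply: subset_trans (connected_in_side oU oV UV0 UVx
  (connected_side cX oU' oV' UV0' UVy) _ _); first by left.
- case=> [U'x|/esym//]; exact: disjoint_sides UV0' U'x V'x.
- by exists y; split => //; right.
Qed.

(** A strict total order whose order topology is coarser than the given one:
    this is all that is retained of the separations. *)
Record open_ray_order (X : topologicalType) (lt : X -> X -> Prop) : Prop := {
  ray_irr : forall x, ~ lt x x ;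
  ray_trans : forall x y z, lt x y -> lt y z -> lt x z ;
  ray_total : forall x y, x <> y -> lt x y \/ lt y x ;
  ray_below : forall x, open [set y | lt y x] ;
  ray_above : forall x, open [set y | lt x y] }.

(** The order is the position on the way from [p] to [q]: [x] precedes [y] when
    [x] is on the [p]-side of [y]. By [cut_pair_swap], used for [(p, q)] and for
    [(q, p)], this means as well that [y] is on the [q]-side of [x], which makes
    the upper rays open. *)
Lemma order_of_cut_pairs (X : topologicalType) (p q : X) :
  connected [set: X] -> (forall x, exists U V, cut_pair p q x U V) ->
  exists lt : X -> X -> Prop, open_ray_order lt.
Proof.
move=> cX /choice[U /choice[V UV]].
have swap x y : U x y -> V y x by exact: cut_pair_swap (UV x) (UV y).
have swap' x y : V x y -> U y x.
  exact: cut_pair_swap (cut_pair_sym (UV x)) (cut_pair_sym (UV y)).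
exists (fun x y => U y x); split.
- move=> x Ux; have [_ _ _ Ex _] := UV x.
  by case: (side_neq Ex (or_introl Ux)).
- by move=> x y z Uyx Uzy; exact: (cut_pair_trans cX (UV z) (UV y)).
- move=> x y xy; have [_ _ _ Ey _] := UV y.
  by have [|/swap'] := union_side Ey xy; [left|right].
- by move=> x; have [] := UV x.
- move=> x; rewrite (_ : [set y | _] = V x); first by have [] := UV x.
  by apply/seteqP; split => y /=; [exact: swap|exact: swap'].
Qed.

(** Without a point in between, the rays below [b] and above [a] would be
    complementary, and so would disconnect the space. *)
Lemma ray_dense (X : topologicalType) (lt : X -> X -> Prop) (a b : X) :
  connected [set: X] -> open_ray_order lt -> lt a b ->
  exists z, lt a z /\ lt z b.
Proof.
move=> cX o ab; apply: contrapT => nz.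
have E : [set y | lt y b] = ~` [set y | lt a y].
  apply/seteqP; split => y /=; first by move=> yb ay; apply: nz; exists y.
  move=> nay; have [->//|/eqP ya] := eqVneq y a.
  by have [ya'|/nay//] := ray_total o ya; exact: ray_trans ya' ab.
have : [set y | lt y b] = [set: X].
  apply: clopen_setT => //; first by exists a.
    exact: ray_below.
  by rewrite E; apply: open_closedC; exact: ray_above.
by move=> /seteqP[_ /(_ b I)]; exact: ray_irr.
Qed.

(** * Irreducibility and cut points *)

(** The continua joining [p] and [q] to the base point meet there, so their
    union is connected. *)
Lemma oneQ2_subcontinuum (X : topologicalType) (Y : set X) (p q : X) :
  oneQ2 Y -> Y p -> Y q ->
  exists C, [/\ C `<=` Y, compact C, connected C, C p & C q].
Proof.
move=> [_ [_ [b _ <-] HY]] /HY[D [[kD cD _] DY Dp [_ [-> Db]]]].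
move=> /HY[D' [[kD' cD' _] DY' Dq [_ [-> Db']]]].
exists (D `|` D'); split.
- by rewrite subUset.
- exact: compactU.
- by apply: connectedU => //; exists b.
- by left.
- by right.
Qed.

Lemma separated_complement (X : topologicalType) (x : X) :
  closed [set x] -> ~ connected (~` [set x]) ->
  exists U V, [/\ open U, open V, U `&` V = set0, U `|` V = ~` [set x] &
    U !=set0 /\ V !=set0].
Proof.
move=> cx /connectedPn[E [E0 EU [cl1 cl2]]].
have ox : open (~` [set x]) by exact: closed_openC.
(* Relative to the open set [~` [set x]], each piece is the complement of the
   closure of the other. *)
have side b : E b = ~` closure (E (~~ b)) `&` ~` [set x].
  have dis : closure (E (~~ b)) `&` E b = set0.
    by case: b; rewrite //= setIC.
  apply/seteqP; split => z.
    move=> Ez; split; first by move=> Cz; exact: disjoint_sides dis Cz Ez.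
    by rewrite EU; case: (b) Ez; [right|left].
  case=> nz; rewrite EU; case: (b) nz => /= nz [] //;
    by move=> /subset_closure.
exists (E false), (E true); split=> //.
- by rewrite side; apply: openI => //; exact/closed_openC/closed_closure.
- by rewrite side; apply: openI => //; exact/closed_openC/closed_closure.
- rewrite -subset0 => z [Ef Et].
  by rewrite -cl1; split=> //; exact: subset_closure.
Qed.

(** If both [p] and [q] were on one side of [x], that side together with [x]
    would be a proper subcontinuum containing them. *)
Lemma irreducible_cut_pair (X : topologicalType) (p q x : X) :
  compact [set: X] -> connected [set: X] -> closed [set x] ->
  (forall C, subcontinuum [set: X] C -> [set p; q] `<=` C -> C = [set: X]) ->
  p <> x -> q <> x -> ~ connected (~` [set x]) ->
  exists U V, cut_pair p q x U V.
Proof.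
move=> kX cX cx irr px qx.
move=> /(separated_complement cx)[U [V [oU oV UV0 UVx [U0 V0]]]].
have split_ends (U' V' : set X) : open U' -> open V' -> U' `&` V' = set0 ->
    U' `|` V' = ~` [set x] -> V' !=set0 -> U' p -> U' q -> False.
  move=> oU' oV' UV0' UVx' [v V'v] Up Uq.
  have E := side_with_point UV0' UVx'.
  suff : ~` V' = [set: X] by move=> /seteqP[_ /(_ v I)].
  rewrite -E; apply: irr; last by move=> z [] ->; left.
  split=> //; first by exists x; right.
    by rewrite E; apply: (subclosed_compact _ kX) => //; exact: open_closedC.
  exact: connected_side UVx'.
have [Up|Vp] := union_side UVx px; have [Uq|Vq] := union_side UVx qx.
- by case: (split_ends U V).
- by exists U, V.
- by exists V, U; apply: cut_pair_sym.
- by case: (split_ends V U); rewrite 1?setIC 1?setUC.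
Qed.

(** * Embedding an ordered continuum in the line *)

(** The running minimum of [h] along the order is continuous at [x]. From above,
    this is the continuity of [h] if the minimum is attained at [x], and the
    openness of an upper ray if it is attained before [x]. From below, the
    compact set where [h] is small lies strictly beyond [x], and by density of
    the order and compactness it also lies beyond every point close to [x]. *)
Lemma running_min (R : realType) (X : topologicalType) (lt : X -> X -> Prop)
    (h : X -> R) :
  compact [set: X] -> connected [set: X] -> open_ray_order lt -> continuous h ->
  exists g : X -> R,
    [/\ continuous g,
        forall x, exists2 y, ~ lt x y & g x = h y &
        forall x y, ~ lt x y -> g x <= h y].
Proof.
move=> kX cX o ch.
have cL x : closed [set y | ~ lt x y] by apply: open_closedC; exact: ray_above.
have /choice[g gE] : forall x, exists r : R,
    (exists2 y, ~ lt x y & r = h y) /\ (forall y, ~ lt x y -> r <= h y).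
  move=> x.
  have [|||y yx ymin] := @compact_EVT_min _ _ h [set y | ~ lt x y].
  - by exists x; exact: ray_irr.
  - exact: (subclosed_compact (cL x) kX).
  - exact: continuous_subspaceT.
  exists (h y); split; first by exists y => //; move: yx; rewrite inE.
  by move=> z zx; apply: ymin; rewrite inE.
exists g; split; [|by move=> x; have [] := gE x|by move=> x; have [] := gE x].
move=> x; apply/cvgrPdist_lt => e e0.
have lo : \forall z \near x, g x - e < g z.
  have kK : compact [set k | h k <= g x - e].
    apply: (subclosed_compact _ kX) => //.
    by apply: (@closed_comp _ _ h [set r | r <= g x - e]).
  have /compact_near_coveringP nK := kK.
  have /nK : forall k, [set k | h k <= g x - e] k ->
      \forall k' \near k & z \near x, lt z k'.
    move=> k /= hk.
    have xk : lt x k.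
      apply: contrapT => /(gE x).2 gk.
      by have := le_trans gk hk; rewrite leNgt ltrBlDr ltrDl e0.
    have [w [xw wk]] := ray_dense cX o xk.
    exists ([set k | lt w k], [set z | lt z w]) => /=.
      by split; apply: open_nbhs_nbhs; split=> //;
        [exact: ray_above|exact: ray_below].
    by case=> k' z /= [wk' zw]; exact: ray_trans zw wk'.
  apply: filterS => z zK; have [[y zy ->] _] := gE z.
  by rewrite ltNge; apply/negP => hy; exact: zy (zK _ hy).
have hi : \forall z \near x, g z < g x + e.
  have [[y xy gy] _] := gE x.
  have [yx|/eqP yx] := eqVneq y x.
    have : \forall z \near x, h z < g x + e.
      by apply: (cvgr_lt (h x)); [exact: ch|rewrite gy yx ltrDl].
    apply: filterS => z; apply: le_lt_trans; apply: (gE z).2; exact: ray_irr.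
  have {xy}yx : lt y x by have [] := ray_total o yx.
  have : \forall z \near x, lt y z.
    by apply: open_nbhs_nbhs; split=> //; exact: ray_above.
  apply: filterS => z yz; rewrite (@le_lt_trans _ _ (h y))//.
    by apply: (gE z).2 => /(ray_trans o yz); exact: ray_irr.
  by rewrite gy ltrDl.
by near=> z; rewrite ltr_distlC; apply/andP; split; near: z.
Unshelve. all: by end_near. Qed.

(** The sum is a weighted series with weights [2 ^- n], taken as the supremum of
    its partial sums [S n]. Continuity comes from the uniform enclosure between
    [S n] and [S n + 2 * M / 2 ^+ n], the latter being nonincreasing in [n]. *)
Lemma separating_sum (R : realType) (X : topologicalType) (g : nat -> X -> R)
    (M : R) :
  (forall n, continuous (g n)) -> (forall n x, 0 <= g n x <= M) ->
  exists2 f : X -> R, continuous f &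
    forall x y, (forall n, g n x <= g n y) -> (exists n, g n x < g n y) ->
      f x < f y.
Proof.
move=> cg gM.
pose u x n := g n x / 2 ^+ n.
pose S n x := \sum_(i < n) u x i.
have p2 n : 0 < 2 ^+ n :> R by rewrite exprn_gt0.
have u0 x n : 0 <= u x n.
  by rewrite divr_ge0 ?(ltW (p2 n))//; case/andP: (gM n x).
have uM x n : u x n <= M / 2 ^+ n.
  by rewrite ler_pM2r ?invr_gt0//; case/andP: (gM n x).
have SS n x : S n.+1 x = S n x + u x n by rewrite /S big_ord_recr.
have Sle m n x : (m <= n)%N -> S m x <= S n x.
  have /nondecreasing_seqP : forall k, S k x <= S k.+1 x.
    by move=> k; rewrite SS lerDl.
  exact.
pose T n x := S n x + 2 * M / 2 ^+ n.
have TS n x : T n.+1 x <= T n x.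
  rewrite /T SS -addrA lerD2l.
  have -> : 2 * M / 2 ^+ n = M / 2 ^+ n + 2 * M / 2 ^+ n.+1.
    by rewrite exprS; field; rewrite lt0r_neq0.
  by rewrite lerD2r.
have Tle m n x : (m <= n)%N -> T n x <= T m x.
  by have /nonincreasing_seqP : forall k, T k.+1 x <= T k x by []; exact.
have ST m n x : S m x <= T n x.
  have M0 : 0 <= M by case/andP: (gM 0%N x) => /le_trans; apply.
  apply: (le_trans (Sle m (maxn m n) x _)); first exact: leq_maxl.
  apply: le_trans (Tle n (maxn m n) x _); last exact: leq_maxr.
  by rewrite lerDl divr_ge0 ?(ltW (p2 _))// mulr_ge0.
pose f x := sup [set S n x | n in [set: nat]].
have ubT n x : ubound [set S n x | n in [set: nat]] (T n x).
  by move=> _ [m _ <-]; exact: ST.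
have Sf n x : S n x <= f x.
  by apply: ub_le_sup; [exists (T 0%N x); exact: ubT|exists n].
have fT n x : f x <= T n x by apply: ge_sup => //; exists (S 0%N x), 0%N.
exists f.
  move=> x; apply/cvgrPdist_lt => e e0.
  have [n nM] : exists n, 2 * M / 2 ^+ n < e / 2.
    exists (Num.bound (2 * M / (e / 2))).
    rewrite ltr_pdivrMr// [ltRHS]mulrC -ltr_pdivrMr ?divr_gt0//.
    exact: upper_nthrootP.
  have cS : continuous (S n).
    elim: n {nM} => [|n IH].
      rewrite (_ : S 0%N = cst 0); first exact: cst_continuous.
      by apply/funext => z; rewrite /S big_ord0.
    rewrite (_ : S n.+1 = fun z => S n z + u z n).
      move=> z; apply: cvgD; first exact: IH.
      by apply: cvgM; [exact: cg|exact: cvg_cst].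
    by apply/funext => z; rewrite SS.
  have : \forall z \near x, `|S n x - S n z| < e / 2.
    by move/cvgrPdist_lt : (cS x); apply; rewrite divr_gt0.
  apply: filterS => z; rewrite !ltr_distlC => /andP[lo hi].
  have := Sf n x; have := Sf n z; have := fT n x; have := fT n z.
  rewrite /T; lra.
move=> x y gxy [k gk].
have uxy n : u x n <= u y n by rewrite ler_pM2r ?invr_gt0.
pose d := u y k - u x k.
have d0 : 0 < d by rewrite subr_gt0 ltr_pM2r ?invr_gt0.
(* The gain at the index [k] persists in all later partial sums. *)
have Sd n : (k < n)%N -> S n x + d <= S n y.
  move=> kn; rewrite /S (bigD1 (Ordinal kn))//= [leRHS](bigD1 (Ordinal kn))//=.
  rewrite addrAC (_ : u x k + d = u y k) ?lerD2l ?ler_sum//.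
  by rewrite addrC subrK.
rewrite -(ltrD2r d) (@le_lt_trans _ _ (f y))//; last by rewrite ltrDl.
rewrite -lerBrDr; apply: ge_sup; first by exists (S 0%N x), 0%N.
move=> _ [n _ <-]; rewrite lerBrDr.
apply: le_trans (Sf (maxn n k.+1) y).
apply: le_trans (Sd _ _); last by rewrite leq_maxr.
by rewrite lerD2r Sle// leq_maxl.
Qed.

Lemma compact_dense_sequence (R : realType) (X : metricType R) (p : X) :
  compact [set: X] ->
  exists d : nat -> X, forall x (e : R), 0 < e -> exists n, mdist (d n) x < e.
Proof.
(* [Y] is [X] made into a pointed space, as second countability requires. *)
pose Y : pseudoPMetricType R :=
  HB.pack (Metric.sort X) (isPointed.Build (Metric.sort X) p).
move=> kX; have [B cB [oB nB]] := @compact_second_countable R Y kX.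
have /pfcard_geP[B0|[F]] := cB.
  have [A [BA _] _] := nB p setT filterT.
  by rewrite B0 in BA.
exists (fun n => xget p (F n)) => x e e0.
have [A [BA Ax] Ae] := nB x _ (nbhsx_ballx x e e0).
have [n _ FA] := 'surj_F BA.
exists n; rewrite FA metric_sym.
have /Ae : A (xget p A) by apply: (xgetPex p); exists x.
by rewrite ballEmdist.
Qed.

Lemma mdist_continuous (R : realType) (X : metricType R) (a : X) :
  continuous (mdist a : X -> R).
Proof.
move=> x; apply/cvgrPdist_lt => e e0.
apply: filterS (nbhsx_ballx x e e0) => z; rewrite ballEmdist /= => xz.
have := metric_triangle a x z; have := metric_triangle a z x.
by rewrite (metric_sym z x) ltr_distlC; lra.
Qed.

Lemma compact_mdist_bounded (R : realType) (X : metricType R) (p : X) :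
  compact [set: X] -> exists M : R, forall x y : X, mdist x y <= M.
Proof.
move=> kX; have [||c _ cmax] := @compact_EVT_max _ _ (mdist p) _ _ kX.
- by exists p.
- exact/continuous_subspaceT/mdist_continuous.
exists (mdist p c + mdist p c) => x y.
apply: le_trans (metric_triangle x p y) _.
by rewrite (metric_sym x p) lerD// cmax// inE.
Qed.

(** For a dense sequence [d], the distance from [d n] to the closed set of
    points up to [x] is continuous in [x] by [running_min] and nonincreasing.
    When [x] precedes [y], the point [y] is at positive distance from the points
    up to [x], so a [d n] close enough to [y] makes the [n]-th distance drop
    strictly between [x] and [y]. Summing up gives a strictly decreasing
    function. *)
Lemma ordered_continuum_embedding (R : realType) (X : metricType R) (p : X)
    (lt : X -> X -> Prop) :
  compact [set: X] -> connected [set: X] -> open_ray_order lt ->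
  exists2 f : X -> R, continuous f & injective f.
Proof.
move=> kX cX o.
have [d dd] := compact_dense_sequence p kX.
have [M distM] := compact_mdist_bounded p kX.
have /choice[g gE] n := running_min kX cX o (@mdist_continuous R X (d n)).
have [n|n x|f cf fmono] := @separating_sum R X g M.
- by have [] := gE n.
- by have [_ /(_ x)[y _ ->] _] := gE n; rewrite mdist_ge0 distM.
have flt x y : lt x y -> f y < f x.
  move=> xy; apply: fmono => [n|].
    have [_ gat gle] := gE n; have [z zx ->] := gat x.
    by apply: gle => yz; apply: zx; exact: ray_trans xy yz.
  have /nbhs_ballP[r /= r0 ry] : nbhs y [set z | lt x z].
    by apply: open_nbhs_nbhs; split=> //; exact: ray_above.
  have [n dn] := dd y (r / 2) (divr_gt0 r0 (ltr0Sn _ 1)).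
  exists n; have [_ gat gle] := gE n; have [z zx ->] := gat x.
  apply: (@le_lt_trans _ _ (mdist (d n) y)).
    by apply: gle; exact: ray_irr.
  apply: (lt_le_trans dn); rewrite leNgt; apply/negP => dz.
  apply: zx; apply: ry; rewrite ballEmdist /=.
  have := metric_triangle y (d n) z; have := dn; rewrite (metric_sym y (d n)).
  lra.
exists f => // x y fxy; apply: contrapT => /(ray_total o)[] /flt;
  by rewrite fxy ltxx.
Qed.

(** After rescaling, the image is the interval [0, 1] because it is connected
    and contains the extreme values; the inverse is continuous because images
    of closed sets are compact. *)
Lemma injection_arc (R : realType) (X : topologicalType) (f : X -> R) :
  continuum [set: X] -> continuous f -> injective f -> is_arc R X.
Proof.
move=> [kX cX [x0 [x1 [_ _ x01]]]] cf inj_f.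
have ne : [set: X] !=set0 by exists x0.
have cf' := continuous_subspaceT cf.
have [a _ amin] := compact_EVT_min ne kX (cf' _).
have [b _ bmax] := compact_EVT_max ne kX (cf' _).
have fa x : f a <= f x by apply: amin; rewrite inE.
have fb x : f x <= f b by apply: bmax; rewrite inE.
have ab : 0 < f b - f a.
  rewrite subr_gt0 lt_neqAle fa andbT; apply/eqP => E; apply: x01; apply: inj_f.
  have const x : f x = f a by apply/eqP; rewrite eq_le fa andbT E fb.
  by rewrite !const.
pose F x := (f x - f a) / (f b - f a).
have cF : continuous F.
  move=> x; apply: cvgM; last exact: cvg_cst.
  by apply: cvgB; [exact: cf|exact: cvg_cst].
have F01 x : (`[0, 1]%classic : set R) (F x).
  rewrite /= in_itv /= divr_ge0 ?subr_ge0 ?(ltW ab)//=.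
  by rewrite ler_pdivrMr// mul1r lerD2r.
have Fsurj (t : R) : (`[0, 1]%classic : set R) t -> exists x, F x = t.
  move=> /=; rewrite in_itv /= => t01.
  have /connected_intervalP iF : connected (range F).
    by apply: connected_continuous_connected => //; exact: continuous_subspaceT.
  have [||x _ <-] := iF 0 1 _ _ t t01; last by exists x.
  - by exists a => //; rewrite /F subrr mul0r.
  - by exists b => //; rewrite /F divff// lt0r_neq0.
have Finj : injective F.
  move=> x y /(mulIf _); rewrite invr_eq0 lt0r_neq0// => /(_ isT)/addIr.
  exact: inj_f.
have /choice[G GE] (t : set_type (`[0, 1]%classic : set R)) :
    exists x, F x = set_val t.
  by apply: Fsurj; exact: set_valP.
pose F' x : set_type (`[0, 1]%classic : set R) :=
  exist _ (F x) (mem_set (F01 x)).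
exists F', G; split.
- by move=> x; apply: Finj; rewrite GE.
- by move=> t; apply: val_inj; rewrite /= GE.
- by apply: continuous_comp_initial; exact: cF.
- apply/continuous_closedP => C cC.
  have -> : G @^-1` C = set_val @^-1` (F @` C).
    apply/seteqP; split => t /=; first by move=> Ct; exists (G t).
    by move=> [x Cx]; rewrite -GE => /Finj <-.
  apply: closed_comp => [t _|]; first exact: initial_continuous.
  apply: compact_closed; first exact: Rhausdorff.
  apply: continuous_compact; first exact: continuous_subspaceT.
  exact: subclosed_compact cC kX _.
Qed.

(** * A characterization of the arc among irreducible continua *)

Theorem theorem5p17 (R : realType) (X : metricType R)
  (Xcont : continuum [set: X]) (Xirr : irreducible [set: X])
  (hNC : NC_1 X `&` F_1 [set: X] = NWC_1 X `&` F_1 [set: X]) :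
  is_arc R X.
Proof.
have [kX cX [x0 [x1 [_ _ x01]]]] := Xcont.
have [p [q [_ _ irr]]] := Xirr.
have c1 (x : X) : closed [set x].
  exact/accessible_closed_set1/hausdorff_accessible/metric_hausdorff.
have nX1 (x : X) : [set x] <> [set: X].
  by move=> /seteqP[_ E]; apply: x01; rewrite (E x0 I) (E x1 I).
(* If [x] does not cut [X], then by hypothesis its complement is 1-Q2, so some
   continuum avoiding [x] contains [p] and [q]. *)
have cut x : p <> x -> q <> x -> ~ connected (~` [set x]).
  move=> px qx cx; have F1x : F_1 [set: X] [set x] by exists x.
  have : (NC_1 X `&` F_1 [set: X]) [set x].
    split=> //; split.
      by split=> //; [exists x|exact: compact_set1].
    rewrite setTD => _ _ [y yx <-] [z zx <-].
    by rewrite !connected_component_id.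
  rewrite hNC => -[[_ [/nX1//|Q2]] _]; rewrite setTD in Q2.
  have [C [Cx kC cC Cp Cq]] := oneQ2_subcontinuum Q2 px qx.
  have CT : C = [set: X].
    by apply: irr; [split=> //; exists p|move=> _ [] ->].
  by apply: (Cx x) => //; rewrite CT.
have [lt o] : exists lt : X -> X -> Prop, open_ray_order lt.
  apply: (order_of_cut_pairs (p := p) (q := q) cX) => x.
  have [xp|/eqP/nesym px] := eqVneq x p.
    exists set0, (~` [set p]); rewrite xp.
    by split; rewrite ?set0I ?set0U//; [exact: open0|exact: closed_openC].
  have [xq|/eqP/nesym qx] := eqVneq x q.
    exists (~` [set q]), set0; rewrite xq.
    by split; rewrite ?setI0 ?setU0//; [exact: closed_openC|exact: open0].
  exact: irreducible_cut_pair (cut x px qx).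
have [f cf fI] := ordered_continuum_embedding p kX cX o.
exact: injection_arc cf fI.
Qed.
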